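(* Let $\hat m,\hat n\in S^2$ with $\hat m^{\mathrm T}\hat n\in[0,1)$, and put $\delta=\arccos\hat m^{\mathrm T}\hat n\in(0,\pi/2]$ and $\hat l=\|\hat m\times\hat n\|^{-1}\,\hat m\times\hat n$. For an arbitrary $U\in\mathrm{SU}(2)$, choose parameters $\alpha',\gamma'\in\mathbb R$ and $\beta'\in[0,\pi]$ such that $$R_{\hat l}(-\delta)\,U=R_{\hat m}(\alpha')R_{\hat l}(\beta')R_{\hat m}(\gamma').$$ Then $$U=R_{\hat n}(\alpha')R_{\hat l}(\beta'+\delta)R_{\hat m}(\gamma').$$ Furthermore, for any $k'\in\mathbb N$ and any $\beta'_1,\dots,\beta'_{k'}\in(0,2\delta]$ satisfying $\beta'+\delta=\beta'_1+\cdots+\beta'_{k'}$, there exist $\alpha'_j,\gamma'_j,\theta'_j\in\mathbb R$ such that $$R_{\hat l}(\beta'_j)=R_{\hat m}(-\alpha'_j)R_{\hat n}(\theta'_j)R_{\hat m}(-\gamma'_j)\qquad(j=1,\dots,k').$$ For these parameters it holds that $$U=R_{\hat n}(\alpha')\,R_{\hat m}(-\alpha'_1)R_{\hat n}(\theta'_1)\,R_{\hat m}(-\gamma'_1-\alpha'_2)R_{\hat n}(\theta'_2)\,R_{\hat m}(-\gamma'_2-\alpha'_3)R_{\hat n}(\theta'_3)\cdots R_{\hat m}(-\gamma'_{k'-1}-\alpha'_{k'})R_{\hat n}(\theta'_{k'})\,R_{\hat m}(-\gamma'_{k'}+\gamma').$$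
   Context: $\mathbb N$ is the set of strictly positive integers; $S^2=\{\hat v\in\mathbb R^3:\|\hat v\|=1\}$; $\arccos$ takes values in $[0,\pi]$. $I$ is the $2\times2$ identity matrix and $X=\begin{pmatrix}0&1\\1&0\end{pmatrix}$, $Y=\begin{pmatrix}0&-i\\i&0\end{pmatrix}$, $Z=\begin{pmatrix}1&0\\0&-1\end{pmatrix}$. For $\hat v=(v_x,v_y,v_z)^{\mathrm T}\in S^2$ and $\theta\in\mathbb R$, $$R_{\hat v}(\theta)=(\cos\tfrac\theta2)I-i(\sin\tfrac\theta2)(v_xX+v_yY+v_zZ)\in \mathrm{SU}(2).$$ (Since $\hat l\perp\hat m$, parameters $\alpha',\gamma'\in\mathbb R$, $\beta'\in[0,\pi]$ as in the claim always exist, by the generalised Euler-angle parameterisation of $\mathrm{SU}(2)$.) *)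

(* Defs.v *)
From HB Require Import structures.
From mathcomp Require Export all_boot all_order all_algebra.
From mathcomp Require Export complex.
From mathcomp Require Export reals trigo.

Set Implicit Arguments.
Unset Strict Implicit.
Unset Printing Implicit Defensive.

Import Order.TTheory GRing.Theory Num.Theory.
Local Open Scope ring_scope.
Local Open Scope complex_scope.

Section Vectors.
Variable R : realType.
Implicit Types u v : 'cV[R]_3.

Definition vx v : R := v 0 0.
Definition vy v : R := v 1 0.
Definition vz v : R := v 2%R 0.

Definition dotv u v : R := (u^T *m v) 0 0.

(* The library norm on matrices is the sup norm, so the Euclidean norm is
   defined here. *)
Definition normv v : R := Num.sqrt (dotv v v).

Definition crossv u v : 'cV[R]_3 :=
  \col_i [:: vy u * vz v - vz u * vy v;
             vz u * vx v - vx u * vz v;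
             vx u * vy v - vy u * vx v]`_i.

Definition sphere2 : {pred 'cV[R]_3} := [pred v | normv v == 1].

End Vectors.

Section SU2.
Variable R : realType.
Notation C := R[i].

Definition mx2 (a b c d : C) : 'M[C]_2 :=
  \matrix_(i, j) (nth [::] [:: [:: a; b]; [:: c; d]] i)`_j.

Definition pauliX : 'M[C]_2 := mx2 0 1 1 0.
Definition pauliY : 'M[C]_2 := mx2 0 (- 'i%C) 'i%C 0.
Definition pauliZ : 'M[C]_2 := mx2 1 0 0 (-1).

Definition Rot (v : 'cV[R]_3) (theta : R) : 'M[C]_2 :=
  (cos (theta / 2))%:C *: 1%:M
  - ('i%C * (sin (theta / 2))%:C) *:
      ((vx v)%:C *: pauliX + (vy v)%:C *: pauliY + (vz v)%:C *: pauliZ).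

Definition SU2 : {pred 'M[C]_2} :=
  [pred U | (U \is unitarymx) && (\det U == 1)].

End SU2.

Arguments sphere2 {R}.
Arguments SU2 {R}.

(* Main.v *)
(* Put d = delta.  In the right-handed orthonormal frame (m, l x m, l) one has
   n = cos d m + sin d (l x m), so that R_l(d) R_m(t) = R_n(t) R_l(d); this
   gives the formula for U.  All matrices involved are real quaternions over the
   frame, and a product R_m(.) R_l(b) R_m(.) has an explicit quaternion in which
   the two outer angles can be prescribed by polar coordinates.  Matching it
   with R_n(t) forces sin(t/2) = sin(b/2) / sin d, which is solvable because
   0 < b <= 2 d <= pi.  The final product telescopes. *)
From mathcomp Require Import boolp ring lra.
Require Import Defs.
Set Implicit Arguments.
Unset Strict Implicit.
Unset Printing Implicit Defensive.

Import Order.TTheory GRing.Theory Num.Theory.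
Local Open Scope ring_scope.
Local Open Scope complex_scope.

(** * Ring identities for rearranging products of rotations *)

Lemma mul_sandwich (T : pzRingType) (x x' u y y' : T) :
  x' * x = 1 -> y * y' = 1 -> x' * (x * u * y) * y' = u.
Proof. by move=> xx yy; rewrite !mulrA xx mul1r -mulrA yy mulr1. Qed.

(** Cancelling [x'] gives [u = x * a * b * c], and the intertwining [v * x = x * a] moves [x] past
    [a]. Meant for [x] a rotation about l, [a] about m and [v] about n. *)
Lemma mul_conj_solve (T : pzRingType) (x x' u v a b c : T) :
  x * x' = 1 -> v * x = x * a -> x' * u = a * b * c -> u = v * (x * b) * c.
Proof.
by move=> xx vx x'u; rewrite mulrA vx -!mulrA (mulrA a) -x'u mulrA xx mul1r.
Qed.

(** [L] turns the sum into a product of sandwiches, in which each [M (- c j.-1)] meets the next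
    [M (- a j)]; the two merge because [M] is additive too. The first left factor and the last right
    factor have no partner and stay outside the product. *)
Lemma sandwich_telescope (V : zmodType) (T : pzRingType) (L M : V -> T)
    (N : nat -> T) (k : nat) (b a c : nat -> V) (g : V) (p : T) :
    {morph L : x y / x + y >-> x * y} -> {morph M : x y / x + y >-> x * y} ->
    (0 < k)%N ->
    (forall j, (1 <= j <= k)%N -> L (b j) = M (- a j) * N j * M (- c j)) ->
  p * L (\sum_(1 <= j < k.+1) b j) * M g =
    p * (M (- a 1%N) * N 1%N)
    * (\prod_(2 <= j < k.+1) (M (- c j.-1 - a j) * N j)) * M (- c k + g).
Proof.
move=> LD MD k_gt0 bE.
suff -> : L (\sum_(1 <= j < k.+1) b j) =
    M (- a 1%N) * N 1%N * (\prod_(2 <= j < k.+1) (M (- c j.-1 - a j) * N j))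
    * M (- c k) by rewrite MD !mulrA.
case: k k_gt0 bE => // k _; elim: k => [|k IHk] bE.
  by rewrite big_nat1 big_geq // mulr1 bE.
rewrite big_nat_recr // LD IHk => [|j /andP[j1 jk]]; last first.
  by apply: bE; rewrite j1 leqW.
by rewrite bE ?leqnn // [in RHS]big_nat_recr //= MD !mulrA.
Qed.

(** * Dot and cross products in coordinates *)

Section VectorAlgebra.
Variable R : realType.
Implicit Types u v w : 'cV[R]_3.

Lemma col3P u v : vx u = vx v -> vy u = vy v -> vz u = vz v -> u = v.
Proof.
move=> ex ey ez; apply/colP => i.
have [->|->|->] // : [\/ i = 0, i = 1 | i = 2%R].
by case: i => [[|[|[|//]]] lti];
  [constructor 1|constructor 2|constructor 3]; exact: val_inj.
Qed.

Lemma vxD u v : vx (u + v) = vx u + vx v. Proof. exact: mxE. Qed.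
Lemma vyD u v : vy (u + v) = vy u + vy v. Proof. exact: mxE. Qed.
Lemma vzD u v : vz (u + v) = vz u + vz v. Proof. exact: mxE. Qed.
Lemma vxZ a u : vx (a *: u) = a * vx u. Proof. exact: mxE. Qed.
Lemma vyZ a u : vy (a *: u) = a * vy u. Proof. exact: mxE. Qed.
Lemma vzZ a u : vz (a *: u) = a * vz u. Proof. exact: mxE. Qed.
Lemma vx_cross u v : vx (crossv u v) = vy u * vz v - vz u * vy v.
Proof. exact: mxE. Qed.
Lemma vy_cross u v : vy (crossv u v) = vz u * vx v - vx u * vz v.
Proof. exact: mxE. Qed.
Lemma vz_cross u v : vz (crossv u v) = vx u * vy v - vy u * vx v.
Proof. exact: mxE. Qed.

Definition vcoordE :=
  (vxD, vyD, vzD, vxZ, vyZ, vzZ, vx_cross, vy_cross, vz_cross).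

Lemma sum_ord3 (F : 'I_3 -> R) : \sum_i F i = F 0 + F 1 + F 2%R.
Proof.
rewrite !big_ord_recl big_ord0 addr0 addrA.
by congr (_ + _ + _); congr (F _); exact: val_inj.
Qed.

Lemma dotvE u v : dotv u v = vx u * vx v + vy u * vy v + vz u * vz v.
Proof.
by rewrite /dotv !mxE sum_ord3 !mxE.
Qed.

Lemma dotvC u v : dotv u v = dotv v u.
Proof. by rewrite !dotvE; ring. Qed.

Lemma dotvDr u v w : dotv u (v + w) = dotv u v + dotv u w.
Proof. by rewrite !dotvE !vcoordE; ring. Qed.

Lemma dotvDl u v w : dotv (v + w) u = dotv v u + dotv w u.
Proof. by rewrite !dotvE !vcoordE; ring. Qed.

Lemma dotvZr a u v : dotv u (a *: v) = a * dotv u v.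
Proof. by rewrite !dotvE !vcoordE; ring. Qed.

Lemma dotvZl a u v : dotv (a *: u) v = a * dotv u v.
Proof. by rewrite !dotvE !vcoordE; ring. Qed.

Lemma dotv_ge0 u : 0 <= dotv u u.
Proof. by rewrite dotvE -!expr2 !addr_ge0 ?sqr_ge0. Qed.

Lemma sqr_normv u : normv u ^+ 2 = dotv u u.
Proof. by rewrite sqr_sqrtr ?dotv_ge0. Qed.

Lemma sphere2P u : u \in sphere2 -> dotv u u = 1.
Proof. by rewrite inE => /eqP nu; rewrite -sqr_normv nu expr1n. Qed.

Lemma dot_crossl u v : dotv u (crossv u v) = 0.
Proof. by rewrite dotvE !vcoordE; ring. Qed.

Lemma dot_crossr u v : dotv v (crossv u v) = 0.
Proof. by rewrite dotvE !vcoordE; ring. Qed.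

Lemma dot_cross_cross u v :
  dotv (crossv u v) (crossv u v) = dotv u u * dotv v v - dotv u v ^+ 2.
Proof. by rewrite !dotvE !vcoordE; ring. Qed.

(** The triple product expansion, with a negated coefficient in place of a difference so that
    [vcoordE] applies directly. *)
Lemma cross_crossr u v w :
  crossv u (crossv v w) = dotv u w *: v + (- dotv u v) *: w.
Proof. by apply: col3P; rewrite !vcoordE !dotvE; ring. Qed.

Lemma cross_crossl u v w :
  crossv (crossv u v) w = dotv u w *: v + (- dotv v w) *: u.
Proof. by apply: col3P; rewrite !vcoordE !dotvE; ring. Qed.

Lemma crossZl a u v : crossv (a *: u) v = a *: crossv u v.
Proof. by apply: col3P; rewrite !vcoordE; ring. Qed.

(** Multiplicativity of the quaternion norm, i.e. Euler's four-square identity. *)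
Lemma quat_norm (a b : R) u v :
  (a * b - dotv u v) ^+ 2
    + dotv (a *: v + b *: u + crossv u v) (a *: v + b *: u + crossv u v) =
  (a ^+ 2 + dotv u u) * (b ^+ 2 + dotv v v).
Proof. by rewrite !dotvE !vcoordE; ring. Qed.

End VectorAlgebra.

(** * SU(2) as the unit quaternions *)

Section Quaternions.
Variable R : realType.
Implicit Types u v w : 'cV[R]_3.
Local Notation C := R[i].

Lemma mx2P (A B : 'M[C]_2) :
  A 0 0 = B 0 0 -> A 0 1 = B 0 1 -> A 1 0 = B 1 0 -> A 1 1 = B 1 1 -> A = B.
Proof.
move=> e00 e01 e10 e11; apply/matrixP => i j.
have ord2 (k : 'I_2) : k = 0 \/ k = 1.
  by case: k => [[|[|//]] ltk]; [left|right]; exact: val_inj.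
by case: (ord2 i) => ->; case: (ord2 j) => ->.
Qed.

Lemma mulmx2E (A B : 'M[C]_2) i j :
  (A * B) i j = A i 0 * B 0 j + A i 1 * B 1 j.
Proof.
rewrite mxE !big_ord_recl big_ord0 addr0.
by congr (_ + _ * _); congr (_ _ _); exact: val_inj.
Qed.

(** The quaternion with real part [a] and vector part [v], where -iX, -iY, -iZ serve as the three
    imaginary units. *)
Definition quatmx (a : R) v : 'M[C]_2 :=
  mx2 (a -i* vz v) (- vy v -i* vx v) (vy v -i* vx v) (a +i* vz v).

Lemma quatmxM a b u v :
  quatmx a u * quatmx b v =
  quatmx (a * b - dotv u v) (a *: v + b *: u + crossv u v).
Proof.
by apply: mx2P; rewrite mulmx2E !mxE /=; apply/eqP; rewrite eq_complex /=;
   apply/andP; split; apply/eqP; rewrite ?vcoordE ?dotvE; ring.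
Qed.

Lemma RotE v t : Rot v t = quatmx (cos (t / 2)) (sin (t / 2) *: v).
Proof.
by apply: mx2P; rewrite !mxE /=; apply/eqP; rewrite eq_complex /=;
   apply/andP; split; apply/eqP; rewrite ?vcoordE ?mulr0n ?mulr1n /=; ring.
Qed.

Lemma RotD v s t : dotv v v = 1 -> Rot v (s + t) = Rot v s * Rot v t.
Proof.
move=> vv; rewrite !RotE quatmxM mulrDl cosD sinD; congr quatmx.
  by rewrite dotvZl dotvZr vv mulr1.
by apply: col3P; rewrite !vcoordE; ring.
Qed.

Lemma Rot0 v : Rot v 0 = 1.
Proof.
rewrite RotE mul0r cos0 sin0 scale0r.
by apply: mx2P; rewrite !mxE /=; apply/eqP; rewrite eq_complex /= /vx /vy /vz
  !mxE ?oppr0 !eqxx.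
Qed.

Lemma det_mx2 (A : 'M[C]_2) : \det A = A 0 0 * A 1 1 - A 0 1 * A 1 0.
Proof.
rewrite (expand_det_row _ 0) !big_ord_recl big_ord0 /cofactor !det_mx11 !mxE.
rewrite addr0 /= expr0 mul1r expr1 mulN1r mulrN.
by congr (_ * _ - _ * _); congr (A _ _); exact: val_inj.
Qed.

Lemma RotMN v t : dotv v v = 1 -> Rot v t * Rot v (- t) = 1.
Proof. by move=> vv; rewrite -(RotD _ _ vv) subrr Rot0. Qed.

Lemma RotNM v t : dotv v v = 1 -> Rot v (- t) * Rot v t = 1.
Proof. by move=> vv; rewrite -(RotD _ _ vv) addNr Rot0. Qed.

(** Orthonormal rows and determinant 1 force the second row to be the conjugate of the first,
    swapped and with one sign changed. *)
Lemma SU2_quatmx (U : 'M[C]_2) : U \in SU2 ->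
  exists a v, U = quatmx a v /\ a ^+ 2 + dotv v v = 1.
Proof.
rewrite inE => /andP[/unitarymxP UU /eqP]; rewrite det_mx2 => detU.
have row_dot i j :
    U i 0 * (U j 0)^* + U i 1 * (U j 1)^* = (i == j)%:R.
  have := congr1 (fun A : 'M_2 => A i j) UU.
  by rewrite [X in X = _]mulmx2E !mxE.
have e00 : U 0 0 * (U 0 0)^* + U 0 1 * (U 0 1)^* = 1 := row_dot 0 0.
have e10 : U 1 0 * (U 0 0)^* + U 1 1 * (U 0 1)^* = 0 := row_dot 1 0.
clear row_dot.
(* Multiply by the squared norm 1 of the first row, then regroup so that the determinant and the
   product of the two rows appear. *)
have dE : U 1 1 = (U 0 0)^*.
  rewrite -[LHS]mulr1 -e00.
  transitivity ((U 0 0 * U 1 1 - U 0 1 * U 1 0) * (U 0 0)^*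
    + U 0 1 * (U 1 0 * (U 0 0)^* + U 1 1 * (U 0 1)^*)); first by ring.
  by rewrite detU e10 mul1r mulr0 addr0.
have cE : U 1 0 = - (U 0 1)^*.
  rewrite -[LHS]mulr1 -e00.
  transitivity (U 0 0 * (U 1 0 * (U 0 0)^* + U 1 1 * (U 0 1)^*)
    - (U 0 0 * U 1 1 - U 0 1 * U 1 0) * (U 0 1)^*); first by ring.
  by rewrite detU e10 mul1r mulr0 sub0r.
case a00: (U 0 0) e00 dE => [p q]; case a01: (U 0 1) cE => [r s].
move=> cE e00 dE.
(* Read off from the first row [a - i vz], [- vy - i vx] of [quatmx]. *)
exists p, (\col_i [:: - s; - r; - q]`_i); split.
  by apply: mx2P; rewrite ?a00 ?a01 ?cE ?dE !mxE /=; apply/eqP;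
    rewrite eq_complex /= /vx /vy /vz !mxE /= ?opprK ?eqxx.
rewrite dotvE /vx /vy /vz !mxE /=.
by case: e00 => <- _; ring.
Qed.

End Quaternions.

(** * Polar coordinates and quaternions in an orthonormal frame *)

Section Frames.
Variable R : realType.
Implicit Types (m n l v : 'cV[R]_3) (a b x y z t : R).

Lemma polar_coordinates (x y r : R) : x ^+ 2 + y ^+ 2 = r ^+ 2 ->
  exists phi, x = r * cos phi /\ y = r * sin phi.
Proof.
have [-> | r0] := eqVneq r 0.
  rewrite expr0n /= => /eqP; rewrite paddr_eq0 ?sqr_ge0 // !sqrf_eq0.
  by move=> /andP[/eqP-> /eqP->]; exists 0; rewrite !mul0r.
move=> xyr.
have cs1 : (x / r) ^+ 2 + (y / r) ^+ 2 = 1.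
  by rewrite !expr_div_n -mulrDl xyr divff // expf_neq0.
have c1 : -1 <= x / r <= 1.
  rewrite -ler_norml -(@expr_le1 _ 2) ?normr_ge0 // real_normK ?num_real //.
  by rewrite -cs1 lerDl sqr_ge0.
have sE : sin (acos (x / r)) = `|y / r|.
  by rewrite sin_acos // -cs1 addrAC subrr add0r sqrtr_sqr.
have cE : cos (acos (x / r)) = x / r by rewrite acosK.
have rK z : z = r * (z / r) by rewrite mulrC divfK.
(* [acos] gives a nonnegative sine, so the angle is negated when [y / r] is negative. *)
have [y0 | y0] := leP 0 (y / r).
  by exists (acos (x / r)); rewrite cE sE ger0_norm // -!rK.
by exists (- acos (x / r)); rewrite cosN sinN cE sE ltr0_norm // opprK -!rK.
Qed.

(* The quaternion [a + x i + y j + z k], where [i, j, k] are the images of the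
   right-handed orthonormal frame [(m, crossv l m, l)]. *)
Definition frame_quat m l a x y z :=
  quatmx a (x *: m + y *: crossv l m + z *: l).

Definition orthonormal m l := [/\ dotv m m = 1, dotv l l = 1 & dotv m l = 0].

Lemma dotv_frame m l x y z : orthonormal m l ->
  dotv (x *: m + y *: crossv l m + z *: l) (x *: m + y *: crossv l m + z *: l) =
  x ^+ 2 + y ^+ 2 + z ^+ 2.
Proof.
move=> [mm ll ml]; have lm : dotv l m = 0 by rewrite dotvC.
rewrite !(dotvDl, dotvDr, dotvZl, dotvZr) dot_cross_cross.
by rewrite !(dotvC (crossv l m)) dot_crossl dot_crossr mm ll ml lm; ring.
Qed.

(** Hamilton's product rule: with p = l x m, the cyclic relations m x p = l, p x l = m and l x m = p
    hold. *)
Lemma frame_quatM m l a x y z a' x' y' z' : orthonormal m l ->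
  frame_quat m l a x y z * frame_quat m l a' x' y' z' =
  frame_quat m l (a * a' - x * x' - y * y' - z * z')
    (a * x' + a' * x + y * z' - z * y')
    (a * y' + a' * y + z * x' - x * z')
    (a * z' + a' * z + x * y' - y * x').
Proof.
move=> [mm ll ml]; have lm : dotv l m = 0 by rewrite dotvC.
set p := crossv l m.
have pp : dotv p p = 1 by rewrite dot_cross_cross ll mm lm mulr1 expr0n subr0.
have lp : dotv l p = 0 by exact: dot_crossl.
have mp : dotv m p = 0 by exact: dot_crossr.
have mpE : crossv m p = l.
  by rewrite cross_crossr mm ml oppr0 scale0r addr0 scale1r.
have plE : crossv p l = m.
  by rewrite cross_crossl ll ml oppr0 scale0r addr0 scale1r.
rewrite /frame_quat quatmxM -/p; congr quatmx.
  rewrite !(dotvDl, dotvDr, dotvZl, dotvZr) (dotvC p m) (dotvC p l).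
  by rewrite mm pp ll mp ml lp lm; ring.
have -> : crossv (x *: m + y *: p + z *: l) (x' *: m + y' *: p + z' *: l) =
    (x * y' - y * x') *: crossv m p + (y * z' - z * y') *: crossv p l
    + (z * x' - x * z') *: crossv l m.
  by apply: col3P; rewrite !vcoordE; ring.
rewrite mpE plE -/p.
by apply: col3P; rewrite !vcoordE; ring.
Qed.

Lemma frame_coord m l v : orthonormal m l ->
  exists x y z, v = x *: m + y *: crossv l m + z *: l.
Proof.
move=> [mm ll ml]; have lm : dotv l m = 0 by rewrite dotvC.
pose B : 'M[R]_3 := \matrix_(i, j) ([:: m; crossv l m; l]`_i) j 0.
have BE i j :
    (B *m B^T) i j = dotv [:: m; crossv l m; l]`_i [:: m; crossv l m; l]`_j.
  by rewrite /dotv !mxE; apply: eq_bigr => k _; rewrite !mxE.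
have pp : dotv (crossv l m) (crossv l m) = 1.
  by rewrite dot_cross_cross ll mm lm mulr1 expr0n subr0.
have BB : B *m B^T = 1%:M.
  apply/matrixP => i j; rewrite BE !mxE.
  case: i => [[|[|[|//]]] lti]; case: j => [[|[|[|//]]] ltj] //=;
    by rewrite ?dot_crossl ?dot_crossr // dotvC ?dot_crossl ?dot_crossr.
(* The rows of [B] are the frame; a one-sided inverse of a square matrix is two-sided, so [B *m v]
   holds the coordinates of [v]. *)
have vE : v = B^T *m (B *m v) by rewrite mulmxA (mulmx1C BB) mul1mx.
exists (vx (B *m v)), (vy (B *m v)), (vz (B *m v)); rewrite {1}vE.
apply/colP => i; rewrite mxE sum_ord3 ![B^T _ _]mxE ![B _ _]mxE /=.
by rewrite [RHS]mxE [X in _ = X + _]mxE ![(_ *: _ : 'cV[R]_3) i 0]mxE;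
  congr (_ + _ + _); rewrite mulrC.
Qed.

(** * Rotations and their products in frame coordinates *)

Lemma Rot_axis m l t :
  Rot m t = frame_quat m l (cos (t / 2)) (sin (t / 2)) 0 0.
Proof. by rewrite RotE /frame_quat !scale0r !addr0. Qed.

Lemma Rot_normal m l t :
  Rot l t = frame_quat m l (cos (t / 2)) 0 0 (sin (t / 2)).
Proof. by rewrite RotE /frame_quat !scale0r !add0r. Qed.

Lemma Rot_tilted m l x y t : Rot (x *: m + y *: crossv l m) t =
  frame_quat m l (cos (t / 2)) (sin (t / 2) * x) (sin (t / 2) * y) 0.
Proof. by rewrite RotE /frame_quat scale0r addr0 scalerDr !scalerA. Qed.

Lemma Rot_conj m l d t : orthonormal m l ->
  Rot (cos d *: m + sin d *: crossv l m) t * Rot l d = Rot l d * Rot m t.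
Proof.
move=> on; rewrite Rot_tilted (Rot_axis m l) (Rot_normal m) !frame_quatM //.
(* Everything is expressed through the half angle; the coordinates then agree modulo c^2 + s^2 =
   1. *)
have -> : d = d / 2 + d / 2 by lra.
rewrite cosD sinD -!splitr.
set c := cos (d / 2); set s := sin (d / 2).
have cs : c ^+ 2 + s ^+ 2 = 1 by exact: cos2Dsin2.
have c2 : c ^+ 2 = 1 - s ^+ 2 by rewrite -cs addrK.
by congr frame_quat; ring: c2.
Qed.

(** The outer angles enter only through their half sum and half difference, which are polar angles
    of two independent pairs of coordinates. *)
Lemma Rot_euler m l (al be ga : R) : orthonormal m l ->
  Rot m al * Rot l be * Rot m ga =
  frame_quat m l (cos (be / 2) * cos ((al + ga) / 2))
    (cos (be / 2) * sin ((al + ga) / 2))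
    (- sin (be / 2) * sin ((al - ga) / 2))
    (sin (be / 2) * cos ((al - ga) / 2)).
Proof.
move=> on; rewrite !(Rot_axis m l) (Rot_normal m l) !frame_quatM //.
rewrite !mulrDl !mulNr !(cosD, sinD, cosN, sinN).
by congr frame_quat; ring.
Qed.

Lemma acos_lepihalf x : 0 <= x <= 1 -> acos x <= pi / 2.
Proof.
move=> /andP[x0 x1].
have x11 : -1 <= x <= 1 by rewrite x1 (le_trans _ x0) ?lerN10.
rewrite leNgt; apply/negP => lt_acos.
have pi0 := @pi_gt0 R.
have : cos (acos x) < cos (pi / 2).
  by rewrite ltr_cos // !in_itv /= ?acos_ge0 ?acos_lepi //; lra.
by rewrite acosK // cos_pihalf ltNge x0.
Qed.

(** By [Rot_euler], it suffices to write (a, x) and (z, -y) in polar form: the radii satisfy r^2 +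
    s^2 = 1, so they are the cosine and sine of be/2. *)
Lemma euler_decomposition m l a v : orthonormal m l -> a ^+ 2 + dotv v v = 1 ->
  exists al be ga : R, 0 <= be <= pi /\
    quatmx a v = Rot m al * Rot l be * Rot m ga.
Proof.
move=> on; have [x [y [z ->]]] := frame_coord v on.
rewrite dotv_frame // => norm1.
set r := Num.sqrt (a ^+ 2 + x ^+ 2).
set s := Num.sqrt (z ^+ 2 + (- y) ^+ 2).
have r2 : r ^+ 2 = a ^+ 2 + x ^+ 2 by rewrite sqr_sqrtr // addr_ge0 ?sqr_ge0.
have s2 : s ^+ 2 = z ^+ 2 + (- y) ^+ 2.
  by rewrite sqr_sqrtr // addr_ge0 ?sqr_ge0.
have [phi [aE xE]] := polar_coordinates (esym r2).
have [psi [zE yE]] := polar_coordinates (esym s2).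
have rs : 1 - r ^+ 2 = s ^+ 2 by rewrite r2 s2 -norm1; ring.
have r0 : 0 <= r by exact: sqrtr_ge0.
have s0 : 0 <= s by exact: sqrtr_ge0.
have r1 : r <= 1 by rewrite -(@expr_le1 _ 2) // -subr_ge0 rs sqr_ge0.
have r11 : -1 <= r <= 1 by rewrite r1 (le_trans _ r0) ?lerN10.
have le_pi2 : acos r <= pi / 2 by rewrite acos_lepihalf ?r0.
(* Half sum [phi], half difference [psi]; the middle angle is at most pi because [r] is
   nonnegative. *)
exists (phi + psi), (acos r *+ 2), (phi - psi); split.
  by rewrite mulrn_wge0 ?acos_ge0 //=; lra.
rewrite Rot_euler //.
have -> : acos r *+ 2 / 2 = acos r by lra.
have -> : (phi + psi + (phi - psi)) / 2 = phi by lra.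
have -> : (phi + psi - (phi - psi)) / 2 = psi by lra.
rewrite acosK // sin_acos // rs sqrtr_sqr ger0_norm // mulNr.
by rewrite -aE -xE -zE -yE opprK.
Qed.

(** Equivalently, the tilted rotation equals R_m(al) R_l(b) R_m(ga). Its axis has no l-component,
    which is achieved by (al - ga)/2 = -pi/2; the remaining coordinates then fix t and (al +
    ga)/2. *)
Lemma Rot_normal_factor m l d b : orthonormal m l ->
    0 < d <= pi / 2 -> 0 < b <= 2 * d ->
  exists al ga t : R, Rot l b =
    Rot m (- al) * Rot (cos d *: m + sin d *: crossv l m) t * Rot m (- ga).
Proof.
move=> on /andP[d0 dpi] /andP[b0 b2d]; have [mm _ _] := on.
have pi0 := @pi_gt0 R.
have sd0 : 0 < sin d by apply: sin_gt0_pi; apply/andP; split; lra.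
have sb0 : 0 <= sin (b / 2) by apply: sin_ge0_pi; apply/andP; split; lra.
(* Both [b / 2] and [d] lie where sine is increasing. *)
have sbd : sin (b / 2) <= sin d.
  rewrite leNgt; apply/negP; rewrite ltr_sin; first lra.
    by rewrite in_itv /=; apply/andP; split; lra.
  by rewrite in_itv /=; apply/andP; split; lra.
set w := sin (b / 2) / sin d.
have w1 : -1 <= w <= 1.
  rewrite (le_trans (lerN10 _)) ?(divr_ge0 sb0 (ltW sd0)) //=.
  by rewrite /w ler_pdivrMr // mul1r.
have wE : w * sin d = sin (b / 2) by rewrite divfK ?gt_eqF.
have cw : cos (asin w) ^+ 2 = 1 - w ^+ 2.
  by rewrite -[in RHS](asinK w1) sin2cos2; ring.
(* The scalar and m-coordinates of the tilted rotation form a vector of length |cos(b/2)|; its polar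
   angle will be the half sum. *)
have cos_b : cos (asin w) ^+ 2 + (w * cos d) ^+ 2 = cos (b / 2) ^+ 2.
  by rewrite cw !cos2sin2 -wE !exprMn cos2sin2; ring.
have [phi [cE sE]] := polar_coordinates cos_b.
exists (phi - pi / 2), (phi + pi / 2), (asin w *+ 2).
have -> : Rot (cos d *: m + sin d *: crossv l m) (asin w *+ 2) =
    Rot m (phi - pi / 2) * Rot l b * Rot m (phi + pi / 2).
  rewrite Rot_euler // Rot_tilted.
  have -> : asin w *+ 2 / 2 = asin w by lra.
  have -> : (phi - pi / 2 + (phi + pi / 2)) / 2 = phi by lra.
  have -> : (phi - pi / 2 - (phi + pi / 2)) / 2 = - (pi / 2) by lra.
  rewrite asinK // -cE -sE wE sinN cosN sin_pihalf cos_pihalf.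
  by rewrite mulrN1 opprK mulr0.
by rewrite (mul_sandwich _ (RotNM _ mm) (RotMN _ mm)).
Qed.

End Frames.

(** * The frame built from m and n, and the resulting factorisations of U *)

Theorem proposition2 (R : realType) (m n : 'cV[R]_3)
    (hm : m \in sphere2) (hn : n \in sphere2)
    (hmn : 0 <= dotv m n < 1)
    (U : 'M[R[i]]_2) (hU : U \in SU2) :
  let delta : R := acos (dotv m n) in
  let l : 'cV[R]_3 := (normv (crossv m n))^-1 *: crossv m n in
  (exists alpha beta gamma : R, 0 <= beta <= pi /\
     Rot l (- delta) * U = Rot m alpha * Rot l beta * Rot m gamma) /\
  (forall alpha beta gamma : R, 0 <= beta <= pi ->
     Rot l (- delta) * U = Rot m alpha * Rot l beta * Rot m gamma ->
     U = Rot n alpha * Rot l (beta + delta) * Rot m gamma /\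
     forall (k : nat) (b : nat -> R),
       (0 < k)%N ->
       (forall j : nat, (1 <= j <= k)%N -> 0 < b j <= 2 * delta) ->
       beta + delta = \sum_(1 <= j < k.+1) b j ->
       (exists a c t : nat -> R, forall j : nat, (1 <= j <= k)%N ->
          Rot l (b j) = Rot m (- a j) * Rot n (t j) * Rot m (- c j)) /\
       (forall a c t : nat -> R,
          (forall j : nat, (1 <= j <= k)%N ->
             Rot l (b j) = Rot m (- a j) * Rot n (t j) * Rot m (- c j)) ->
          U = Rot n alpha
              * (Rot m (- a 1%N) * Rot n (t 1%N))
              * (\prod_(2 <= j < k.+1)
                   (Rot m (- c j.-1 - a j) * Rot n (t j)))
              * Rot m (- c k + gamma))).
Proof.
move=> delta l.
have mm := sphere2P hm; have nn := sphere2P hn.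
have [mn0 mn1] := andP hmn.
have mn11 : -1 <= dotv m n <= 1 by rewrite (le_trans (lerN10 _)) // ltW.
have cosd : cos delta = dotv m n by rewrite acosK.
(* Lagrange's identity: |m x n|^2 = 1 - (m . n)^2 for unit vectors. *)
have sind : sin delta = normv (crossv m n).
  by rewrite sin_acos // /normv dot_cross_cross mm nn mulr1.
have d0 : 0 < delta by rewrite acos_gt0 // mn1 (le_trans (lerN10 _)).
have dpi : delta <= pi / 2 by rewrite acos_lepihalf // mn0 ltW.
have pi0 := @pi_gt0 R.
have sd0 : 0 < sin delta by apply: sin_gt0_pi; apply/andP; split; lra.
have lE : l = (sin delta)^-1 *: crossv m n by rewrite sind.
have ll : dotv l l = 1.
  rewrite dotvZl dotvZr -sqr_normv -sind.
  by rewrite mulrA -invfM -expr2 mulVf // expf_neq0 // gt_eqF.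
have on : orthonormal m l by split; rewrite // dotvZr dot_crossl mulr0.
(* Expanding (m x n) x m gives n - (m . n) m, so n is m turned by [delta] about l. *)
have nE : n = cos delta *: m + sin delta *: crossv l m.
  rewrite lE crossZl scalerA divff ?gt_eqF // scale1r cross_crossl mm scale1r.
  by rewrite (dotvC n m) cosd addrCA -scalerDl subrr scale0r addr0.
split.
  have [a [v [-> norm1]]] := SU2_quatmx hU.
  (* The product with R_l(-delta) is again a unit quaternion, by multiplicativity of the norm. *)
  rewrite RotE quatmxM; apply: euler_decomposition => //.
  rewrite quat_norm norm1 mulr1 dotvZl dotvZr ll mulr1 -expr2.
  exact: cos2Dsin2.
move=> al be ga _ UE.
have {}UE : U = Rot n al * Rot l (be + delta) * Rot m ga.
  (* R_l(delta) is split off on the left, where it can be exchanged with R_m(al). *)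
  rewrite addrC (RotD _ _ ll).
  apply: mul_conj_solve (RotMN delta ll) _ UE.
  by rewrite nE; exact: Rot_conj.
split=> [|k b k0 b2d bsum]; first exact: UE.
split.
  (* The three parameters are packed in a triple so that one use of choice yields all three
     sequences; indices outside 1..k get the dummy value (0, 0, 0). *)
  have fact j : exists w : R * R * R, (1 <= j <= k)%N ->
      Rot l (b j) = Rot m (- w.1.1) * Rot n w.2 * Rot m (- w.1.2).
    have [jk | _] := boolP (1 <= j <= k)%N; last by exists (0, 0, 0) => /notF[].
    have d_itv : 0 < delta <= pi / 2 by rewrite d0.
    have [a [c [t bE]]] := Rot_normal_factor on d_itv (b2d j jk).
    by exists (a, c, t) => _; rewrite nE; exact: bE.
  have [f fE] := choice fact.
  exists (fun j => (f j).1.1), (fun j => (f j).1.2), (fun j => (f j).2).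
  exact: fE.
move=> a c t bE.
have LD x y : Rot l (x + y) = Rot l x * Rot l y by exact: RotD.
have MD x y : Rot m (x + y) = Rot m x * Rot m y by exact: RotD.
rewrite UE bsum.
exact: (sandwich_telescope (N := fun j => Rot n (t j)) _ _ LD MD k0 bE).
Qed.
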